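(* Let $p(X)=p_0+p_1X+\cdots+p_nX^n$ and $q(X)=q_0+q_1X+\cdots+q_mX^m$ be real polynomials with $\deg(p(X))=n$ and $\deg(q(X))=m$, and let $h_\delta(X)=p(X)-\delta q(X)$. The degree in $\delta$ of the polynomial $\mathrm{Dis}(h_\delta(X))(\delta)$ satisfies: (1) $\deg(\mathrm{Dis}(h_\delta(X))(\delta))\le 2m-2$ if $m>n$ and $q_m\delta\neq0$; (2) $\deg(\mathrm{Dis}(h_\delta(X))(\delta))\le 2n-2$ if $m<n$ and $p_n\neq0$; (3) $\deg(\mathrm{Dis}(h_\delta(X))(\delta))\le 2n-2$ if $m=n$ and $p_n-q_n\delta\neq0$.
   Context: $\mathrm{Dis}(h_\delta(X))(\delta)$ (the hidden polynomial) is the discriminant of $h_\delta(X)$ with respect to $X$, regarded as a function of $\delta$. The conditions $q_m\delta\ne0$, $p_n\neq0$, $p_n-q_n\delta\neq0$ say that the leading coefficient of $h_\delta(X)$ in $X$ (that of $X^{\max(n,m)}$) is nonzero. For a polynomial $g$ of degree $d$ with leading coefficient $a_d$ and complex roots $\alpha_1,\dots,\alpha_d$ (listed with multiplicity), $\mathrm{Dis}(g)=a_d^{2d-2}\prod_{1\le i<j\le d}(\alpha_i-\alpha_j)^2=(-1)^{d(d-1)/2}a_d^{-1}\mathrm{Res}(g,g')$. *)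

(* Defs.v *)
From mathcomp Require Import all_boot all_order all_algebra.
From mathcomp Require Import reals.
From mathcomp Require Export complex.

Set Implicit Arguments.
Unset Strict Implicit.
Unset Printing Implicit Defensive.

Import GRing.Theory.
Local Open Scope ring_scope.
Local Open Scope complex_scope.

(* A sequence rs with g = lead_coef g *: \prod_(z <- rs) ('X - z%:P); for      *)
(* g != 0 it lists the roots of g with multiplicity.                           *)
Definition poly_roots (F : closedFieldType) (g : {poly F}) : seq F :=
  sval (closed_field_poly_normal g).

(* The subtraction in the exponent is truncated, so a nonzero constant has     *)
(* discriminant 1.                                                             *)
Definition discriminant (F : closedFieldType) (g : {poly F}) : F :=
  let d := (size g).-1 in
  lead_coef g ^+ (2 * d - 2) *
  \prod_(i < d) \prod_(j < d | (i < j)%N)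
    ((poly_roots g)`_i - (poly_roots g)`_j) ^+ 2.

(* The discriminant of a real polynomial, through its complex roots.           *)
Definition Dis (R : realType) (g : {poly R}) : R[i] :=
  discriminant (map_poly (real_complex R) g).

Definition hpoly (R : realType) (p q : {poly R}) (delta : R) : {poly R} :=
  p - delta *: q.

(* D represents the function delta |-> Dis (hpoly p q delta) at all the        *)
(* parameters satisfying adm; D is determined by this if adm holds infinitely  *)
(* often.                                                                      *)
Definition is_hidden_poly (R : realType) (p q : {poly R}) (adm : pred R)
    (D : {poly R}) : Prop :=
  forall delta : R, adm delta -> (D.[delta])%:C = Dis (hpoly p q delta).

(* Main.v *)
Require Import Defs.
From mathcomp Require Import all_boot all_order all_algebra.
From mathcomp Require Import reals.
From mathcomp Require Import zify.

(** For [g] of degree [d >= 2] with leading coefficient [a] and roots [al i],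
    the product [\prod_i g'(al i)] is [a ^ d] times the product of all the
    differences [al i - al j], [i != j]; so, up to the sign [(-1) ^ 'C(d, 2)],
    the discriminant is [a ^ (d - 2) * \prod_i g'(al i)].

    The degree bound would be immediate if the discriminant were a determinant
    of size [2 d - 2] with entries linear in the coefficients of [g], because
    the coefficients of [p - delta q] have degree at most 1 in [delta].  The
    Sylvester matrix of [g] and [g'] has size [2 d - 1], and its determinant
    is the discriminant times [a], up to sign.  The extra factor disappears
    after one step of row elimination: the only nonzero entries in the column
    of degree [2 d - 2] come from the rows [X^(d-1) g'] and [X^(d-2) g], and
    subtracting [d] times the second from the first leaves a single entry
    [a], along which the determinant can be expanded.  What remains is
    [disc_mx], whose rows are the coefficients of
    [X^i g'] for [i < d - 1], of [X^(d-2) (X g' - d g)],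
    and of [X^k g] for [k < d - 2].

    Its determinant is computed in [det_disc_mx_split].  When the roots are
    distinct, multiplying on the right by the powers of the roots evaluates
    each row at each root, which kills the rows [X^k g] and produces a
    Vandermonde matrix scaled by the [g'(al i)]; the remaining columns
    contribute a triangular block with diagonal [a].  When [g] has a multiple
    root, all the rows vanish at it, and so does the determinant.

    The hidden polynomial is then, up to sign, the determinant of [disc_mx] for
    [p - delta q] taken over the polynomials in [delta]
    ([hidden_poly_degree]), of degree at most [2 d - 2] by [size_det_linear].
    In each of the three cases [d] is the larger of the two degrees, and the
    condition on [delta] says that the coefficient of [X^d] in [p - delta q]
    is nonzero; that excludes at most one [delta], hence uniqueness.  Degrees
    [d <= 1] are apart: there the discriminant is constantly 1. *)

Set Implicit Arguments.
Unset Strict Implicit.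
Unset Printing Implicit Defensive.

Import GRing.Theory.
Local Open Scope ring_scope.

(** * The reduced Sylvester matrix of a polynomial and its derivative *)

(** Here [e] is the degree minus two.  Rows are indexed by [nat] so that one
    definition covers both blocks of rows; the second branch is the
    combination that has lost its term of degree [2 e + 2]. *)
Definition disc_row (A : nzRingType) (e : nat) (g : {poly A}) (i : nat) :
    {poly A} :=
  if (i < e.+1)%N then 'X^i * g^`()
  else if i == e.+1 then 'X^e * ('X * g^`() - g *+ e.+2)
  else 'X^(i - e.+2) * g.

Definition disc_mx (A : nzRingType) (e : nat) (g : {poly A}) :
    'M[A]_(e.+2 + e) :=
  \matrix_(i, j) (disc_row e g i)`_j.

Lemma map_disc_mx (A B : nzRingType) (f : {rmorphism A -> B}) e
    (g : {poly A}) :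
  map_mx f (disc_mx e g) = disc_mx e (map_poly f g).
Proof.
apply/matrixP=> i j; rewrite !mxE -coef_map /=; congr _`_j.
rewrite /disc_row deriv_map; case: ifP => _.
  by rewrite rmorphM /= map_polyXn.
by case: ifP => _; rewrite rmorphM /= map_polyXn // rmorphB rmorphM rmorphMn /=
  map_polyX.
Qed.

(** The bound is what makes a row of [disc_mx] carry the whole polynomial.  In
    the middle row the top coefficients of [X g'] and [d g] cancel. *)
Lemma size_disc_row (A : nzRingType) e (g : {poly A}) (i : 'I_(e.+2 + e)) :
  (size g <= e.+3)%N -> (size (disc_row e g i) <= e.+2 + e)%N.
Proof.
move=> /leq_sizeP sg; apply/leq_sizeP => j le_j; rewrite /disc_row.
have lt_i := ltn_ord i.
case: ltnP => [lt_i1 | le_i].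
  by rewrite coefXnM coef_deriv; case: ltnP => // _; rewrite sg ?mul0rn //; lia.
case: eqP => [_|ne_i]; rewrite coefXnM; case: ltnP => // _.
  rewrite coefB coefMn coefXM coef_deriv.
  have: (e.+2 <= j - e)%N by lia.
  case: (j - e)%N => [//|k] /=; rewrite leq_eqVlt => /predU1P[[<-]|lt_k].
    by rewrite subrr.
  by rewrite sg // !mul0rn subrr.
by apply: sg; lia.
Qed.

(** At a root of [g] the correction term [d g] in the middle row is invisible,
    so the first [e + 2] rows are evaluated as if they were all [X^i g']. *)
Lemma horner_disc_row (A : comNzRingType) e (g : {poly A}) x (i : 'I_e.+2) :
  root g x -> (disc_row e g i).[x] = x ^+ i * g^`().[x].
Proof.
move=> /rootP gx; rewrite /disc_row.
case: ltnP => le_i; first by rewrite hornerM hornerXn.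
have -> : i = e.+1 :> nat by have := ltn_ord i; lia.
rewrite eqxx hornerM hornerXn hornerD hornerN hornerMn gx mul0rn subr0.
by rewrite hornerM hornerX mulrA -exprSr.
Qed.

Lemma horner_disc_row_low (A : comNzRingType) e (g : {poly A}) x k :
  root g x -> (disc_row e g (e.+2 + k)).[x] = 0.
Proof.
move=> /rootP gx; rewrite /disc_row ifF; last by lia.
by rewrite ifF; [rewrite hornerM gx mulr0 | lia].
Qed.

(** The powers of a common root of [g] and [g'] form a nonzero vector
    annihilated by every row. *)
Lemma det_disc_mx_multiple_root (F : fieldType) e (g : {poly F}) x :
  (size g <= e.+3)%N -> root g x -> root g^`() x -> \det (disc_mx e g) = 0.
Proof.
move=> sg gx dgx; apply/eqP; rewrite -det_tr; apply/det0P.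
exists (\row_j x ^+ j).
  by apply/eqP=> /rowP/(_ ord0)/eqP; rewrite !mxE expr0 oner_eq0.
apply/rowP=> i; rewrite !mxE.
under eq_bigr => j _ do rewrite !mxE mulrC.
rewrite -horner_coef_wide; last exact: size_disc_row.
case: (splitP i) => k ->.
  by rewrite horner_disc_row // (rootP dgx) mulr0.
exact: horner_disc_row_low.
Qed.

(** Multiply [disc_mx] by the matrix whose first [e + 2] columns list the powers
    of the roots and whose last [e] columns select the coefficients of degree
    at least [e + 2].  The result is block triangular, and the determinant of
    the multiplier is the Vandermonde determinant, which is nonzero and
    cancels. *)
Lemma det_disc_mx_simple_roots (F : fieldType) e (g : {poly F})
    (al : 'I_e.+2 -> F) :
  (size g <= e.+3)%N -> injective al -> (forall i, root g (al i)) ->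
  \det (disc_mx e g) = g`_e.+2 ^+ e * \prod_i g^`().[al i].
Proof.
move=> sg inj_al gal; set M := disc_mx e g.
pose VV : 'M[F]_(e.+2 + e, e.+2) := \matrix_(i, j) al j ^+ i.
pose V := usubmx VV.
pose W := row_mx VV (col_mx 0 1%:M).
have VE : V = Vandermonde e.+2 (\row_j al j).
  by apply/matrixP=> i j; rewrite !mxE.
have detV : \det V != 0.
  rewrite VE det_Vandermonde; apply/prodf_neq0 => i _; apply/prodf_neq0 => j ij.
  by rewrite !mxE subr_eq0 (inj_eq inj_al) neq_ltn ij orbT.
have detW : \det W = \det V.
  by rewrite /W -[VV]vsubmxK -block_mxEh det_lblock det1 mulr1.
(* A row times the powers of [al j] is the value of its polynomial at [al j]. *)
have MVV i j : (M *m VV) i j = (disc_row e g i).[al j].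
  rewrite mxE (horner_coef_wide _ (size_disc_row i sg)).
  by apply: eq_bigr => k _; rewrite !mxE.
have MW : M *m W = block_mx (V *m diag_mx (\row_j g^`().[al j])) (ursubmx M)
                            0 (drsubmx M).
  rewrite mul_mx_row -{2}[M]hsubmxK mul_row_col mulmx0 add0r mulmx1.
  rewrite -[M *m VV]vsubmxK -[rsubmx M]vsubmxK -block_mxEh.
  congr block_mx; apply/matrixP=> i j.
  - by rewrite mul_mx_diag [LHS]mxE MVV horner_disc_row // !mxE.
  - by rewrite !mxE.
  - by rewrite [LHS]mxE MVV horner_disc_row_low // mxE.
  - by rewrite !mxE.
(* The lower right block holds the coefficients of degree at least [e + 2] of
   the rows [X^k g], hence is triangular with the leading coefficient on the
   diagonal. *)
have drE k l : drsubmx M k l = ('X^k * g)`_(e.+2 + l).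
  by rewrite !mxE /disc_row /= !ifF ?addKn //; lia.
apply: (mulIf detV).
have := congr1 determinant MW.
rewrite det_mulmx detW det_ublock det_mulmx det_diag => ->.
have -> : \det (drsubmx M) = g`_e.+2 ^+ e.
  rewrite det_trig.
    rewrite (eq_bigr (fun=> g`_e.+2)); first by rewrite prodr_const card_ord.
    by move=> k _; rewrite drE coefXnM addnK ifF //; lia.
  apply/is_trig_mxP => k l kl; rewrite drE coefXnM ifF; last by lia.
  by move/leq_sizeP: sg; apply; lia.
rewrite mulrC mulrA [LHS]mulrAC; congr (_ * _ * _).
by apply: eq_bigr => i _; rewrite mxE.
Qed.

(** * The discriminant as a determinant *)

Lemma prod_const_ltn_pairs (A : comNzRingType) d (c : A) :
  \prod_(i < d) \prod_(j < d | (i < j)%N) c = c ^+ 'C(d, 2).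
Proof.
rewrite (exchange_big_dep xpredT) //= -bin2_sum big_mkord -prodrXr.
apply: eq_bigr => j _; rewrite prodr_const -[in RHS](card_ord j).
rewrite -!sum1_card (big_ord_widen _ (fun=> 1%N) (ltnW (ltn_ord j))).
by rewrite !sum1_card.
Qed.

(** The pairs [i < j] and [j < i] contribute the same differences up to one sign
    per pair. *)
Lemma prod_diffs (A : comNzRingType) d (al : 'I_d -> A) :
  \prod_i \prod_(j | j != i) (al i - al j) =
  (-1) ^+ 'C(d, 2) * \prod_(i < d) \prod_(j < d | (i < j)%N) (al i - al j) ^+ 2.
Proof.
rewrite -prod_const_ltn_pairs.
under eq_bigr => i _.
  rewrite (bigID (fun j : 'I_d => (i < j)%N)) /=.
  rewrite (eq_bigl (fun j : 'I_d => (i < j)%N)); last first.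
    by move=> j; rewrite neq_ltn; case: ltngtP.
  rewrite [X in _ * X](eq_bigl (fun j : 'I_d => (j < i)%N)); last first.
    by move=> j; rewrite neq_ltn; case: ltngtP.
  over.
rewrite big_split /= [X in _ * X](exchange_big_dep xpredT) //= -!big_split /=.
apply: eq_bigr => i _; rewrite -!big_split /=; apply: eq_bigr => j _.
by rewrite -[al j - al i]opprB mulrN expr2 mulN1r.
Qed.

Lemma deriv_root_prod (A : comNzRingType) d a (al : 'I_d -> A) i :
  (a *: \prod_j ('X - (al j)%:P))^`().[al i] =
  a * \prod_(j | j != i) (al i - al j).
Proof.
rewrite derivZ hornerZ (bigD1 i) //= derivM hornerD !hornerM derivXsubC.
rewrite hornerXsubC subrr mul0r addr0 hornerC mul1r horner_prod.
by congr (_ * _); apply: eq_bigr => j _; rewrite hornerXsubC.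
Qed.

(** For distinct roots, each [g'(al i)] is [a] times a product of differences
    of roots; a repeated root makes both sides vanish, by
    [det_disc_mx_multiple_root] on the left. *)
Lemma det_disc_mx_split (F : fieldType) e a (al : 'I_e.+2 -> F) :
  \det (disc_mx e (a *: \prod_j ('X - (al j)%:P))) =
  (-1) ^+ 'C(e.+2, 2) *
  (a ^+ (2 * e.+2 - 2) *
   \prod_(i < e.+2) \prod_(j < e.+2 | (i < j)%N) (al i - al j) ^+ 2).
Proof.
set P := \prod_j _; set g := a *: P.
have sP : size P = e.+3.
  by rewrite size_prod_XsubC [index_enum _]unlock -enumT size_enum_ord.
have sg : (size g <= e.+3)%N by rewrite -sP size_scale_leq.
have ga : g`_e.+2 = a.
  have /monicP := monic_prod_XsubC (index_enum 'I_e.+2) xpredT al.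
  by rewrite -/P lead_coefE sP coefZ => ->; rewrite mulr1.
have gal i : root g (al i).
  by rewrite /root hornerZ /P (bigD1 i) //= hornerM hornerXsubC subrr mul0r
    mulr0.
have -> : (2 * e.+2 - 2 = e + e.+2)%N by lia.
rewrite mulrCA -prod_diffs exprD.
have prodE : a ^+ e.+2 * \prod_i \prod_(j | j != i) (al i - al j) =
    \prod_i g^`().[al i].
  under [RHS]eq_bigr => i _ do rewrite deriv_root_prod.
  by rewrite big_split /= prodr_const card_ord.
rewrite -mulrA prodE.
have [/injectiveP inj_al | /injectivePn[i [j ne_ij eq_ij]]] :=
  boolP (injectiveb al).
  by rewrite (det_disc_mx_simple_roots sg inj_al gal) ga.
have dg0 : g^`().[al i] = 0.
  by rewrite deriv_root_prod (bigD1 j) 1?eq_sym //= eq_ij subrr mul0r mulr0.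
rewrite (det_disc_mx_multiple_root sg (gal i)); last exact/rootP.
by rewrite (bigD1 i) //= dg0 mul0r mulr0.
Qed.

Lemma discriminant_det (F : closedFieldType) e (g : {poly F}) :
  size g = e.+3 ->
  discriminant g = (-1) ^+ 'C(e.+2, 2) * \det (disc_mx e g).
Proof.
move=> sg; rewrite /discriminant sg /=.
have gE := svalP (closed_field_poly_normal g); rewrite -/(poly_roots g) in gE.
set rs := poly_roots g in gE *; set a := lead_coef g in gE *.
have a0 : a != 0 by rewrite lead_coef_eq0 -size_poly_gt0 sg.
have srs : size rs = e.+2.
  by move: sg; rewrite gE size_scale // size_prod_XsubC => -[].
rewrite gE [\prod_(z <- rs) _](big_nth 0) srs big_mkord det_disc_mx_split.
by rewrite mulrA -expr2 sqrr_sign mul1r.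
Qed.

Lemma discriminant_small (F : closedFieldType) (g : {poly F}) :
  (size g <= 2)%N -> discriminant g = 1.
Proof.
rewrite /discriminant; case: (size g) => [|[|[]]] //= _;
  rewrite expr0 mul1r ?big_ord0 // big1 // => i _; rewrite big1 // => j;
  by rewrite !ord1.
Qed.

(** * Degree and uniqueness of the hidden polynomial *)

Lemma size_det_linear (A : idomainType) N (M : 'M[{poly A}]_N) :
  (forall i j, (size (M i j) <= 2)%N) -> (size (\det M) <= N.+1)%N.
Proof.
move=> sM; apply: (leq_trans (size_sum _ _ _)); apply/bigmax_leqP => s _.
rewrite mulr_sign (fun_if (fun p : {poly A} => size p)) size_polyN if_same.
apply: (leq_trans (size_poly_prod_leq _ _)); rewrite card_ord.
apply: (@leq_trans ((N * 2).+1 - N)); last by lia.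
rewrite leq_sub2r // ltnS -[X in (_ <= X * 2)%N](card_ord N) -sum_nat_const.
by apply: leq_sum.
Qed.

Lemma size_coef_disc_row (A : nzRingType) e (g : {poly {poly A}}) (k : nat) :
  (forall i, (size (g`_i)%R <= k)%N) ->
  forall i j, (size ((disc_row e g i)`_j)%R <= k)%N.
Proof.
move=> sg i j.
have sgn c n : (size (g`_c *+ n)%R <= k)%N.
  by rewrite -scaler_nat (leq_trans (size_scale_leq _ _)).
rewrite /disc_row; case: ifP => _.
  by rewrite coefXnM coef_deriv; case: ifP; rewrite ?size_poly0.
case: ifP => _; rewrite coefXnM; case: ifP; rewrite ?size_poly0 // => _.
rewrite coefB coefMn coefXM coef_deriv (leq_trans (size_polyD _ _)) //.
by rewrite geq_max size_polyN sgn andbT; case: ifP; rewrite ?size_poly0.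
Qed.

(** The product [s * (p - q)] vanishes at every point.  The zeros of [s] stand
    for the values of the parameter at which the degree drops. *)
Lemma eq_poly_horner (A : numDomainType) (s p q : {poly A}) : s != 0 ->
  (forall x, s.[x] != 0 -> p.[x] = q.[x]) -> p = q.
Proof.
move=> s0 pq; apply/eqP; rewrite -subr_eq0.
suff: s * (p - q) == 0 by rewrite mulf_eq0 (negbTE s0).
set r := s * _.
apply/eqP/(@roots_geq_poly_eq0 _ _ [seq i%:R | i <- iota 0 (size r)]).
- apply/allP => x _; rewrite /root hornerM hornerD hornerN.
  by have [->|/pq->] := eqVneq s.[x] 0; rewrite ?mul0r // subrr mulr0.
- by rewrite map_inj_uniq ?iota_uniq //;
  apply: Num.Theory.mulrIn; apply: oner_neq0.
- by rewrite size_map size_iota.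
Qed.

(** The three cases at once: [d] is any common bound on the degrees of [p] and
    [q] that at least one of them reaches. *)
Lemma hidden_poly_degree (R : realType) d (p q : {poly R}) (adm : pred R) :
  (size p <= d.+1)%N -> (size q <= d.+1)%N -> (p`_d != 0) || (q`_d != 0) ->
  (forall x, adm x = (p`_d - q`_d * x != 0)) ->
  exists D : {poly R},
    unique (is_hidden_poly p q adm) D /\ ((size D).-1 <= 2 * d - 2)%N.
Proof.
move=> sp sq pq0 admE.
suff [D [hD sD]] : exists D,
    is_hidden_poly p q adm D /\ ((size D).-1 <= 2 * d - 2)%N.
  exists D; split=> //; split=> // D' hD'.
  pose s : {poly R} := (p`_d)%:P - q`_d *: 'X.
  have s0 : s != 0.
    apply/eqP => /polyP s0; move: (s0 0%N) (s0 1%N) pq0.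
    rewrite !coefE !mulr1 mulr0 subr0 sub0r => -> /eqP.
    by rewrite oppr_eq0 eqxx => ->.
  apply: (eq_poly_horner s0) => x sx.
  have ax : adm x by rewrite admE; move: sx; rewrite !hornerE.
  have : ((D.[x])%:C)%C = ((D'.[x])%:C)%C by rewrite hD ?hD'.
  exact: complexI.
have size_h x : adm x -> size (map_poly (real_complex R) (hpoly p q x)) = d.+1.
  rewrite admE size_map_poly => hx.
  apply/eqP; rewrite eqn_leq; apply/andP; split.
    rewrite (leq_trans (size_polyD _ _)) // geq_max sp size_polyN.
    exact: leq_trans (size_scale_leq _ _) sq.
  apply: (contra_neqT _ hx); rewrite -leqNgt => /leq_sizeP/(_ d (leqnn d)).
  by rewrite coefB coefZ mulrC => ->.
have [d1|] := leqP d 1.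
  exists 1; split; last by rewrite size_poly1.
  move=> x /size_h sh; rewrite /Dis discriminant_small ?sh // hornerC.
  exact: rmorph1.
case: d => [|[|e]] // in sp sq pq0 admE size_h * => _.
(* [p - delta q] with the parameter [delta] as the inner indeterminate. *)
pose H : {poly {poly R}} := map_poly polyC p - 'X *: map_poly polyC q.
have H_eval x : map_poly (horner_eval x) H = hpoly p q x.
  apply/polyP=> i; rewrite coef_map /= /horner_eval.
  by rewrite !(coefB, coefZ, coef_map) /= !hornerE.
exists ((-1) ^+ 'C(e.+2, 2) * \det (disc_mx e H)); split.
  move=> x /size_h sh.
  rewrite /Dis (discriminant_det sh) -map_disc_mx det_map_mx -H_eval.
  rewrite -map_disc_mx det_map_mx -[_.[x]]/(horner_eval x _).
  by rewrite !rmorphM !rmorphXn !rmorphN1.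
have sH k : (size (H`_k)%R <= 2)%N.
  rewrite coefB coefZ !coef_map (leq_trans (size_polyD _ _)) //.
  rewrite geq_max size_polyN (leq_trans (size_polyC_leq1 _)) //=.
  by rewrite mulrC mul_polyC (leq_trans (size_scale_leq _ _)) ?size_polyX.
have sdet : (size (\det (disc_mx e H)) <= (e.+2 + e).+1)%N.
  by apply: size_det_linear => i j; rewrite mxE; apply: size_coef_disc_row.
rewrite -signr_odd mulr_sign (fun_if (fun f : {poly R} => size f)).
rewrite size_polyN if_same.
by rewrite -subn1 leq_subLR (leq_trans sdet) //; lia.
Qed.

Theorem lemma4 (R : realType) (n m : nat) (p q : {poly R})
    (degp : size p = n.+1) (degq : size q = m.+1) :
  [/\ (n < m)%N ->
        exists D : {poly R},
          unique (is_hidden_poly p q (fun delta => q`_m * delta != 0)) D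
          /\ ((size D).-1 <= 2 * m - 2)%N,
      (m < n)%N ->
        exists D : {poly R},
          unique (is_hidden_poly p q (fun delta => p`_n != 0)) D
          /\ ((size D).-1 <= 2 * n - 2)%N
    & m = n ->
        exists D : {poly R},
          unique (is_hidden_poly p q (fun delta => p`_n - q`_n * delta != 0)) D
          /\ ((size D).-1 <= 2 * n - 2)%N].
Proof.
have pn0 : p`_n != 0.
  by have := lead_coef_eq0 p; rewrite lead_coefE -size_poly_eq0 degp => ->.
have qm0 : q`_m != 0.
  by have := lead_coef_eq0 q; rewrite lead_coefE -size_poly_eq0 degq => ->.
split=> [lt_nm | lt_mn | eq_mn]; apply: hidden_poly_degree;
  rewrite ?degp ?degq ?pn0 ?qm0 ?orbT ?ltnS ?eq_mn
    ?(ltnW lt_nm) ?(ltnW lt_mn) //.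
  by move=> x; rewrite [p`_m]nth_default ?degp // sub0r oppr_eq0.
by move=> x; rewrite [q`_n]nth_default ?degq // mul0r subr0.
Qed.
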